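(* Let $L$ be the Heisenberg Lie algebra over the finite field $\mathbb{F}_q$, i.e. the three-dimensional Lie algebra with basis $e,f,h$ and brackets $[e,f]=h$, $[e,h]=[f,h]=0$. Let $Z=Z(L)=L'=\langle h\rangle$, let $\mathcal{L}$ be the set of one-dimensional subalgebras (lines) and $\mathcal{P}$ the set of two-dimensional subalgebras (planes) of $L$. The line $Z$ is central, and the other $q^2+q$ lines are noncentral. Further, $\mathcal{P}$ consists of the $q+1$ two-dimensional subspaces containing $Z$. The comaximal graph $\Gamma(L)$ has vertex set $\mathcal{L}\sqcup\mathcal{P}$, and adjacency is given by: (1) If $A,B\in\mathcal{P}$ with $A\neq B$, then $A\sim B$. Hence $\Gamma(L)[\mathcal{P}]\cong K_{q+1}$. (2) The central line $Z$ is an isolated vertex of $\Gamma(L)$, and two distinct noncentral lines $A,B\in\mathcal{L}$ are adjacent if and only if they are not both contained in the same plane of $\mathcal{P}$. Consequently, the induced subgraph on $\mathcal{L}\setminus\{Z\}$ is the complete multipartite graph $K_{q,\ldots,q}$ with $q+1$ parts of size $q$. (3) For $A\in\mathcal{L}$ and $B\in\mathcal{P}$, $A\sim B$ if and only if $A\not\subseteq B$. In particular, $Z$ is an isolated vertex. Further, every noncentral line has degree $q^2+q$, and every plane has degree $q^2+q$.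
   Context: The comaximal graph $\Gamma(L)$ of a finite-dimensional Lie algebra $L$ is the simple undirected graph whose vertices are the nonzero proper Lie subalgebras of $L$, two distinct vertices $A,B$ being adjacent (written $A\sim B$) if and only if $\langle A,B\rangle=L$, where $\langle A,B\rangle$ denotes the Lie subalgebra generated by $A\cup B$. For a set $S$ of vertices, $\Gamma(L)[S]$ is the subgraph induced on $S$. $L'=[L,L]$ is the derived algebra and $Z(L)$ the center. *)

(* Defs.v *)
From HB Require Import structures.
From mathcomp Require Import all_boot all_order all_algebra.

Set Implicit Arguments.
Unset Strict Implicit.
Unset Printing Implicit Defensive.

Import GRing.Theory.
Local Open Scope ring_scope.

HB.mixin Record isLieAlgebra (K : fieldType) V of Vector K V := {
  lie : V -> V -> V;
  lie_linearl : forall a x y z, lie (a *: x + y) z = a *: lie x z + lie y z;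
  lie_linearr : forall a x y z, lie z (a *: x + y) = a *: lie z x + lie z y;
  liexx : forall x, lie x x = 0;
  lie_jacobi : forall x y z,
    lie x (lie y z) + lie y (lie z x) + lie z (lie x y) = 0
}.

#[short(type="lieAlgType")]
HB.structure Definition LieAlgebra (K : fieldType) :=
  { V of isLieAlgebra K V & Vector K V }.

Section FiniteSubspaces.

Import VectorInternalTheory.

HB.instance Definition _ (F : finFieldType) (V : vectType F) :=
  [Countable of {vspace V} by <:].
HB.instance Definition _ (F : finFieldType) (V : vectType F) :=
  [Finite of {vspace V} by <:].

End FiniteSubspaces.

Section LieSubspaces.

Variables (K : fieldType) (L : lieAlgType K).
Implicit Types (U V W : {vspace L}) (x y : L).

HB.instance Definition _ z :=
  GRing.isLinear.Build K L L *:%R (lie z)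
    (fun a x y => lie_linearr a x y z).
Definition lie_right y x : L := lie x y.
HB.instance Definition _ z :=
  GRing.isLinear.Build K L L *:%R (lie_right z)
    (fun a x y => lie_linearl a x y z).

(* Brackets of basis vectors already span all brackets: see lie_productP. *)
Definition lie_product U V : {vspace L} :=
  <<[seq lie u v | u <- vbasis U, v <- vbasis V]>>%VS.

Definition lie_derived : {vspace L} := lie_product fullv fullv.

(* It is enough to commute with a basis of L: see lie_centerP. *)
Definition lie_center : {vspace L} :=
  (\bigcap_(y <- vbasis {:L}) lker (linfun (lie_right y)))%VS.

Definition lie_subalgebra U : bool := (lie_product U U <= U)%VS.

Definition heisenberg_basis (e f h : L) : Prop :=
  [/\ basis_of {:L} [:: e; f; h], lie e f = h, lie e h = 0 & lie f h = 0].

Lemma lie_productP U V W :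
  reflect (forall u v, u \in U -> v \in V -> lie u v \in W)
          (lie_product U V <= W)%VS.
Proof.
apply: (iffP idP) => [sUVW u v Uu Vv | sUVW].
  rewrite (coord_vbasis Uu) (coord_vbasis Vv) linear_sum memv_suml // => j _.
  rewrite linearZ memvZ //= -[lie _ _]/(lie_right _ _) linear_sum memv_suml // => i _.
  rewrite linearZ memvZ //=; apply: (subvP sUVW); apply: memv_span.
  by apply: allpairs_f; rewrite mem_nth // size_tuple.
apply/span_subvP=> _ /allpairsP[[u v] /= [Uu Vv ->]].
by apply: sUVW; apply: vbasis_mem.
Qed.

Lemma lie_subalgebraP U :
  reflect {in U &, forall u v, lie u v \in U} (lie_subalgebra U).
Proof.
by apply: (iffP (lie_productP U U U)) => sU u v Uu Uv; apply: sU.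
Qed.

Lemma lie_centerP x :
  reflect (forall y, lie x y = 0) (x \in lie_center).
Proof.
have capP : (x \in lie_center) = all (fun y => lie x y == 0) (vbasis {:L}).
  rewrite /lie_center; elim: (tval (vbasis _)) => [|y s IHs] /=.
    by rewrite big_nil memvf.
  rewrite big_cons memv_cap IHs memv_ker; congr (_ && _).
  by rewrite lfunE.
rewrite capP; apply: (iffP allP) => [cx y | cx y _]; last exact/eqP/cx.
rewrite (coord_vbasis (memvf y)) linear_sum big1 // => i _.
by rewrite linearZ /= (eqP (cx _ _)) ?scaler0 // mem_nth // size_tuple.
Qed.

End LieSubspaces.

(* A finite simple graph on a subset of an ambient finite type T. *)
Record sgraph (T : finType) := SGraph {
  vertices : {set T};
  adj : rel T;
  adj_vertices : forall x y, adj x y -> (x \in vertices) && (y \in vertices);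
  adj_sym : symmetric adj;
  adj_irr : irreflexive adj
}.

Section Graphs.

Variables (T : finType) (G : sgraph T).

Definition isolated (x : T) : Prop :=
  x \in vertices G /\ forall y, ~~ adj G x y.

Definition degree (x : T) : nat := #|[set y | adj G x y]|.

Definition induced_adj (S : {set T}) : rel T :=
  [rel x y | [&& x \in S, y \in S & adj G x y]].

Fact induced_vertices S x y :
  induced_adj S x y -> (x \in vertices G :&: S) && (y \in vertices G :&: S).
Proof.
by case/and3P=> Sx Sy /adj_vertices/andP[Gx Gy]; rewrite !inE Sx Sy Gx Gy.
Qed.

Fact induced_sym S : symmetric (induced_adj S).
Proof. by move=> x y; rewrite /induced_adj /= adj_sym andbCA. Qed.

Fact induced_irr S : irreflexive (induced_adj S).
Proof. by move=> x; rewrite /induced_adj /= adj_irr !andbF. Qed.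

Definition induced S : sgraph T :=
  SGraph (@induced_vertices S) (induced_sym S) (induced_irr S).

End Graphs.

Definition graph_iso (T1 T2 : finType) (G1 : sgraph T1) (G2 : sgraph T2) :=
  exists2 phi : {x | x \in vertices G1} -> {y | y \in vertices G2},
    bijective phi &
    forall x y, adj G2 (val (phi x)) (val (phi y)) = adj G1 (val x) (val y).

Section Multipartite.

Fact complete_adj_vertices (T : finType) (x y : T) :
  x != y -> (x \in [set: T]) && (y \in [set: T]).
Proof. by rewrite !inE. Qed.

Fact complete_adj_sym (T : finType) : symmetric [rel x y : T | x != y].
Proof. by move=> x y; rewrite /= eq_sym. Qed.

Fact complete_adj_irr (T : finType) : irreflexive [rel x y : T | x != y].
Proof. by move=> x; rewrite /= eqxx. Qed.

Definition complete_graph (n : nat) : sgraph 'I_n :=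
  SGraph (@complete_adj_vertices 'I_n)
         (@complete_adj_sym 'I_n) (@complete_adj_irr 'I_n).

Variables (m : nat) (part : 'I_m -> nat).

(* The pair (i, j) is the j-th vertex of the i-th part. *)
Let vertex : finType := {i : 'I_m & 'I_(part i)}.
Let multi_adj : rel vertex := [rel x y | tag x != tag y].

Fact multi_adj_vertices x y :
  multi_adj x y -> (x \in [set: vertex]) && (y \in [set: vertex]).
Proof. by rewrite !inE. Qed.

Fact multi_adj_sym : symmetric multi_adj.
Proof. by move=> x y; rewrite /multi_adj /= eq_sym. Qed.

Fact multi_adj_irr : irreflexive multi_adj.
Proof. by move=> x; rewrite /multi_adj /= eqxx. Qed.

Definition complete_multipartite_graph : sgraph {i : 'I_m & 'I_(part i)} :=
  SGraph multi_adj_vertices multi_adj_sym multi_adj_irr.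

End Multipartite.

Section ComaximalGraph.

Variables (F : finFieldType) (L : lieAlgType F).
Implicit Types A B U W : {vspace L}.

(* The smallest Lie subalgebra of L containing A and B. *)
Definition lie_generated A B : {vspace L} :=
  (\bigcap_(W : {vspace L} | [&& lie_subalgebra W, A <= W & B <= W]) W)%VS.

Definition comaximal_vertices : {set {vspace L}} :=
  [set U | [&& lie_subalgebra U, U != 0%VS & U != fullv]].

Definition comaximal_adj : rel {vspace L} :=
  [rel A B | [&& A \in comaximal_vertices, B \in comaximal_vertices,
                 A != B & lie_generated A B == fullv]].

Fact comaximal_adj_vertices A B :
  comaximal_adj A B ->
  (A \in comaximal_vertices) && (B \in comaximal_vertices).
Proof. by case/and4P=> -> ->. Qed.

Fact comaximal_adj_sym : symmetric comaximal_adj.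
Proof.
move=> A B; rewrite /comaximal_adj /= andbCA eq_sym; congr [&& _, _, _ & _ == _].
by apply: eq_bigl => W; congr (_ && _); rewrite andbC.
Qed.

Fact comaximal_adj_irr : irreflexive comaximal_adj.
Proof. by move=> A; rewrite /comaximal_adj /= eqxx !andbF. Qed.

Definition comaximal_graph : sgraph {vspace L} :=
  SGraph comaximal_adj_vertices comaximal_adj_sym comaximal_adj_irr.

Definition lie_lines : {set {vspace L}} :=
  [set U | lie_subalgebra U & \dim U == 1%N].

Definition lie_planes : {set {vspace L}} :=
  [set U | lie_subalgebra U & \dim U == 2%N].

Definition noncentral_lines : {set {vspace L}} :=
  [set U in lie_lines | ~~ (U <= lie_center L)%VS].

Lemma lie_generatedP A B :
  [/\ lie_subalgebra (lie_generated A B),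
      (A <= lie_generated A B)%VS, (B <= lie_generated A B)%VS &
      forall W, lie_subalgebra W -> (A <= W)%VS -> (B <= W)%VS ->
        (lie_generated A B <= W)%VS].
Proof.
split.
- apply/lie_productP => u v gu gv; apply/subv_bigcapP => W PW.
  have sgW : (lie_generated A B <= W)%VS by apply: (bigcapv_inf W).
  case/and3P: (PW) => /lie_subalgebraP subW _ _.
  by apply: subW; apply: (subvP sgW).
- by apply/subv_bigcapP => W /and3P[].
- by apply/subv_bigcapP => W /and3P[].
- by move=> W sW AW BW; apply: (bigcapv_inf W); rewrite ?sW ?AW ?BW.
Qed.

End ComaximalGraph.

(* Main.v *)
(* If A is a subalgebra and A + Z = L then A = L, since brackets only see vectors
   modulo Z and [e, f] = h spans Z.  Hence a two-dimensional subalgebra contains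
   Z, Z is isolated, and A, B generate L iff A + B + Z = L.  For vertices other
   than Z, the spaces A + Z and B + Z are planes, so A ~ B iff A + Z != B + Z:
   away from Z the graph is complete multipartite, its q + 1 parts being the
   fibres of A |-> A + Z, that is, a plane together with its q noncentral lines. *)
Require Import Defs.
From mathcomp Require Import all_boot all_order all_algebra.
From mathcomp Require Import finfield.

Set Implicit Arguments.
Unset Strict Implicit.
Unset Printing Implicit Defensive.

Import GRing.Theory.

(** * Isomorphisms with complete and complete multipartite graphs *)

(** The model graph [G2] is mapped into [G1], as enumerations naturally run in that direction. An
    injection into a finite set that is no larger is bijective, and its inverse is the
    isomorphism. *)
Lemma graph_isoI (T1 T2 : finType) (G1 : sgraph T1) (G2 : sgraph T2)
    (psi : T2 -> T1) :
    vertices G2 = [set: T2] -> (forall y, psi y \in vertices G1) ->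
    injective psi -> #|vertices G1| <= #|T2| ->
    (forall x y, adj G1 (psi x) (psi y) = adj G2 x y) ->
  graph_iso G1 G2.
Proof.
move=> vG2 psiV psi_inj leVT adj_psi.
pose f (y : {y | y \in vertices G2}) : {x | x \in vertices G1} :=
  exist _ (psi (val y)) (psiV (val y)).
have f_inj : injective f by move=> y z [/psi_inj/val_inj].
have [g fK gK] : bijective f.
  by apply: inj_card_bij f_inj _; rewrite !card_sig vG2 cardsT.
exists g => [|x y]; first by exists f.
by rewrite -{2}[x]gK -{2}[y]gK -adj_psi.
Qed.

Lemma graph_iso_complete (T : finType) (G : sgraph T) (m : nat) :
    #|vertices G| = m ->
    {in vertices G &, forall x y, adj G x y = (x != y)} ->
  graph_iso G (complete_graph m).
Proof.
move=> cardV adjV; pose psi (i : 'I_m) := enum_val (cast_ord (esym cardV) i).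
have psi_inj : injective psi by move=> i j /enum_val_inj/cast_ord_inj.
apply: (@graph_isoI _ _ _ _ psi) => // [i||x y]; first exact: enum_valP.
  by rewrite cardV card_ord.
by rewrite adjV ?enum_valP // (inj_eq psi_inj).
Qed.

(** The map [c] sends a vertex to the label of its part. Enumerating [P] and then each fibre of [c]
    matches the pair [(i, j)] with a vertex of [G]. *)
Lemma graph_iso_multipartite (T I : finType) (G : sgraph T) (P : {set I})
    (c : T -> I) (m n : nat) :
    #|P| = m -> {in vertices G, forall x, c x \in P} ->
    {in P, forall i, #|[set x in vertices G | c x == i]| = n} ->
    {in vertices G &, forall x y, adj G x y = (c x != c y)} ->
  graph_iso G (complete_multipartite_graph (fun _ : 'I_m => n)).
Proof.
move=> cardP cP cardc adjV.
pose p (i : 'I_m) := enum_val (cast_ord (esym cardP) i).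
have pP i : p i \in P by apply: enum_valP.
have p_inj : injective p by move=> i j /enum_val_inj/cast_ord_inj.
pose psi (u : {i : 'I_m & 'I_n}) :=
  enum_val (cast_ord (esym (cardc _ (pP (tag u)))) (tagged u)).
have psiP u : (psi u \in vertices G) && (c (psi u) == p (tag u)).
  have := enum_valP (cast_ord (esym (cardc _ (pP (tag u)))) (tagged u)).
  by rewrite inE.
have psiV u : psi u \in vertices G by case/andP: (psiP u).
have cpsi u : c (psi u) = p (tag u) by case/andP: (psiP u) => _ /eqP.
have psi_inj : injective psi.
  move=> [i j] [i' j'] eq_psi.
  have eq_i : i = i'.
    by apply/p_inj; rewrite -[LHS](cpsi (Tagged (fun=> 'I_n) j)) eq_psi cpsi.
  (* The enumerated fibre depends on the part, so the parts must be identified before the positions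
     [j] and [j'] can be compared. *)
  by case: _ / eq_i j' eq_psi => j' /enum_val_inj/cast_ord_inj /= ->.
apply: (graph_isoI _ psiV psi_inj) => // [|u v]; last first.
  by rewrite adjV // !cpsi (inj_eq p_inj).
(* Both sides are [m * n]: the vertices of [G] are counted fibre by fibre over [P]. *)
rewrite card_tagged sumnE big_map big_enum /= sum_nat_const !card_ord.
rewrite -sum1_card (partition_big c [in P]) //= -cardP -sum_nat_const.
rewrite leq_eqVlt; apply/orP; left; apply/eqP/eq_bigr => i Pi.
by rewrite -(cardc i Pi) -sum1_card; apply: eq_bigl => x; rewrite !inE.
Qed.

Lemma induced_adjE (T : finType) (G : sgraph T) (S : {set T}) (x y : T) :
  adj (induced G S) x y = [&& x \in S, y \in S & adj G x y].
Proof. by []. Qed.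

(** * Dimensions and counting of subspaces over a finite field *)

Lemma dim_add_line (K : fieldType) (V : vectType K) (U : {vspace V}) (v : V) :
  v \notin U -> \dim (U + <[v]>) = (\dim U).+1.
Proof.
move=> U'v; have nz_v : v != 0%R by apply: contraNneq U'v => ->; apply: mem0v.
rewrite dimv_disjoint_sum ?dim_vline ?nz_v ?addn1 //.
apply/eqP; rewrite -subv0; apply/subvP => w /memv_capP[Uw /vlineP[k def_w]].
rewrite memv0 def_w scaler_eq0 (negPf nz_v) orbF; apply: contraNT U'v => nz_k.
by rewrite -[v]scale1r -(mulVf nz_k) -scalerA -def_w memvZ.
Qed.

Lemma card_vspace_set (F : finFieldType) (V : vectType F) (U : {vspace V}) :
  #|[set v : finvect_type V | v \in U]| = (#|F| ^ \dim U)%N.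
Proof.
(* [card_vspace] wants a finite type carrying a vector space structure; opening [V] exposes the
   structure [cT] to be put on [finvect_type]. *)
case: V U => T cT U; rewrite cardsE.
have <- := @card_vspace F (finvect_type (Vector.Pack cT)) cT U.
exact: eq_card.
Qed.

(* Count the vectors of [W] outside [U] by the space they span with [U]. *)
Lemma card_subv_cover (F : finFieldType) (V : vectType F) (U W : {vspace V}) :
    (U <= W)%VS ->
  (#|[set M : {vspace V} | [&& (U <= M)%VS, (M <= W)%VS
                             & \dim M == (\dim U).+1]]|
     * (#|F| ^ (\dim U).+1 - #|F| ^ \dim U)
   = #|F| ^ \dim W - #|F| ^ \dim U)%N.
Proof.
pose fV := finvect_type V => sUW.
have cardD (A B : {vspace V}) : (A <= B)%VS ->
    #|[set v : fV | (v \in B) && (v \notin A)]|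
      = (#|F| ^ \dim B - #|F| ^ \dim A)%N.
  move=> sAB; rewrite -!card_vspace_set -cardsDS; last first.
    by apply/subsetP => v; rewrite !inE => /(subvP sAB).
  by apply: eq_card => v; rewrite !inE andbC.
rewrite -cardD // -sum_nat_const -[RHS]sum1_card.
set S := [set M | _].
rewrite (partition_big (fun v : fV => U + <[v : V]>)%VS [in S]) /=; last first.
  move=> v; rewrite !inE => /andP[Wv U'v].
  by rewrite addvSl subv_add sUW -memvE Wv dim_add_line /=.
(* The vectors that span [M] together with [U] are exactly those of [M] outside [U]. *)
apply: eq_bigr => M; rewrite inE => /and3P[sUM sMW /eqP dimM].
rewrite -dimM -cardD // -sum1_card; apply: eq_bigl => v; rewrite !inE.
apply/andP/andP => [[Mv U'v] | [/andP[_ U'v] /eqP <-]].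
  split; first by rewrite (subvP sMW).
  by rewrite eqEdim subv_add sUM -memvE Mv dim_add_line // dimM leqnn.
by split=> //; apply: (subvP (addvSr U _)); apply: memv_line.
Qed.

(** * Bilinearity and antisymmetry of the bracket; lines are subalgebras *)

Section LieBracket.

Variables (K : fieldType) (L : lieAlgType K).
Implicit Types (a : K) (x y z : L).

Local Open Scope ring_scope.

Lemma lieDl x y z : lie (x + y) z = lie x z + lie y z.
Proof. exact: (linearD (lie_right z)). Qed.

Lemma lieZl a x z : lie (a *: x) z = a *: lie x z.
Proof. exact: (linearZ_LR (lie_right z)). Qed.

Lemma lieDr x y z : lie z (x + y) = lie z x + lie z y.
Proof. exact: linearD. Qed.

Lemma lieZr a x z : lie z (a *: x) = a *: lie z x.
Proof. exact: linearZ_LR. Qed.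

Lemma lieC x y : lie x y = - lie y x.
Proof.
(* Polarisation: expand [lie (x + y) (x + y) = 0]. *)
apply/eqP; rewrite -addr_eq0; have := liexx (x + y).
by rewrite lieDl !lieDr !liexx add0r addr0 => ->.
Qed.

Lemma lie_subalgebra_dim1 (U : {vspace L}) : \dim U = 1%N -> lie_subalgebra U.
Proof.
move=> dimU; pose u := vpick U.
have nz_u : u != 0 by rewrite vpick0 -dimv_eq0 dimU.
have defU : U = <[u]>%VS.
  by apply/eqP; rewrite eq_sym eqEdim -memvE memv_pick dim_vline nz_u dimU.
rewrite defU; apply/lie_subalgebraP => _ _ /vlineP[a ->] /vlineP[b ->].
by rewrite lieZl lieZr liexx !scaler0 mem0v.
Qed.

End LieBracket.

(** * The Heisenberg algebra over an arbitrary field *)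

Section Heisenberg.

Local Open Scope ring_scope.

Variables (K : fieldType) (L : lieAlgType K) (e f h : L).
Hypothesis basisL : heisenberg_basis e f h.

Local Notation Z := (<[h]>%VS : {vspace L}).

Lemma heisenberg_coord (x : L) : exists a b c, x = a *: e + b *: f + c *: h.
Proof.
have [/span_basis defL _ _ _] := basisL.
have: x \in <<[:: e; f; h]>>%VS by rewrite defL memvf.
rewrite !span_cons span_nil addv0.
case/memv_addP=> _ /vlineP[a ->] [w bc ->].
case/memv_addP: bc => _ /vlineP[b ->] [_ /vlineP[c ->] ->].
by exists a, b, c; rewrite addrA.
Qed.

(** The coefficient is the determinant of the [e], [f] coordinates; those along [h] drop out because
    [h] is central. *)
Lemma heisenberg_lie a b c a' b' c' :
  lie (a *: e + b *: f + c *: h) (a' *: e + b' *: f + c' *: h)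
    = (a * b' - b * a') *: h.
Proof.
have [_ lef leh lfh] := basisL.
rewrite !(lieDl, lieDr, lieZl, lieZr) !liexx lef leh lfh.
rewrite (lieC f e) (lieC h e) (lieC h f) lef leh lfh.
by rewrite !(scaler0, oppr0, add0r, addr0, scalerN) !scalerA scalerBl addrC.
Qed.

Lemma heisenberg_neq0 : h != 0.
Proof. by have [/basis_not0-> //] := basisL; rewrite !inE eqxx !orbT. Qed.

Lemma heisenberg_lie_in_center (x y : L) : lie x y \in Z.
Proof.
have [a [b [c ->]]] := heisenberg_coord x.
have [a' [b' [c' ->]]] := heisenberg_coord y.
by rewrite heisenberg_lie memvZ // memv_line.
Qed.

Local Close Scope ring_scope.

Lemma dim_heisenberg : \dim {:L} = 3.
Proof. by have [/size_basis] := basisL. Qed.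

Lemma dim_heisenberg_center : \dim Z = 1.
Proof. by rewrite dim_vline heisenberg_neq0. Qed.

Lemma heisenberg_center : lie_center L = Z.
Proof.
have [_ lef leh lfh] := basisL.
apply/eqP; rewrite eqEsubv; apply/andP; split; apply/subvP=> x.
  move/lie_centerP=> cx; have [a [b [c def_x]]] := heisenberg_coord x.
  have scale_eq0 k : (k *: h = 0 -> k = 0)%R.
    by move/eqP; rewrite scaler_eq0 (negPf heisenberg_neq0) orbF => /eqP.
  (* Bracketing the central [x] with [f] isolates [a]; bracketing it with [e] isolates [b] up to
     sign. *)
  have /scale_eq0 a0 : (a *: h = 0)%R.
    rewrite -(cx f) def_x !lieDl !lieZl lef liexx (lieC h f) lfh.
    by rewrite oppr0 !scaler0 !addr0.
  have /scale_eq0 b0 : (b *: h = 0)%R.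
    apply: oppr_inj; rewrite oppr0 -(cx e) def_x !lieDl !lieZl liexx (lieC f e).
    by rewrite (lieC h e) lef leh oppr0 !scaler0 addr0 add0r scalerN.
  by rewrite def_x a0 b0 !scale0r !add0r memvZ // memv_line.
case/vlineP=> k ->; apply/lie_centerP => y.
have [a [b [c ->]]] := heisenberg_coord y.
rewrite lieZl !lieDr !lieZr liexx (lieC h e) (lieC h f) leh lfh.
by rewrite oppr0 !scaler0 !addr0 scaler0.
Qed.

Lemma heisenberg_derived : lie_derived L = Z.
Proof.
have [_ lef _ _] := basisL.
apply/eqP; rewrite eqEsubv; apply/andP; split.
  by apply/lie_productP => u v _ _; apply: heisenberg_lie_in_center.
have /lie_productP := subvv (lie_derived L).
by rewrite -memvE -lef; apply; rewrite memvf.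
Qed.

Lemma lie_subalgebra_above_center (U : {vspace L}) :
  (Z <= U)%VS -> lie_subalgebra U.
Proof.
move=> sZU; apply/lie_subalgebraP => u v _ _.
exact/(subvP sZU)/heisenberg_lie_in_center.
Qed.

(* Modulo [Z] brackets do not change, so [A] contains [lie e f = h]. *)
Lemma lie_subalgebra_add_center (A : {vspace L}) :
  lie_subalgebra A -> (A + Z)%VS = fullv -> A = fullv.
Proof.
move=> /lie_subalgebraP subA defL; rewrite -[RHS]defL; apply/esym/addv_idPl.
have [_ lef _ _] := basisL.
have cZ z y : z \in Z -> lie z y = 0%R.
  by rewrite -heisenberg_center => /lie_centerP.
have /memv_addP[a Aa [z Zz def_e]] : e \in (A + Z)%VS by rewrite defL memvf.
have /memv_addP[b Ab [t Zt def_f]] : f \in (A + Z)%VS by rewrite defL memvf.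
rewrite -memvE -lef def_e def_f lieDl (cZ z) // addr0 lieDr.
by rewrite (lieC a t) (cZ t) // oppr0 addr0 subA.
Qed.

End Heisenberg.

(** * Adjacency and counting in the comaximal graph over a finite field *)

Section HeisenbergComaximal.

Variables (F : finFieldType) (L : lieAlgType F) (e f h : L).
Hypothesis basisL : heisenberg_basis e f h.

Local Notation q := #|F|.
Local Notation Z := (<[h]>%VS : {vspace L}).
Local Notation G := (comaximal_graph L).
Local Notation lines := (lie_lines L).
Local Notation planes := (lie_planes L).
Local Notation nclines := (noncentral_lines L).
Implicit Types A B P Q U : {vspace L}.

(** The space [A + B + Z] contains [Z], so it is a subalgebra above [A] and [B]. Conversely, if it
    is [L], then the generated subalgebra plus [Z] is [L], so the generated subalgebra is already
    [L]. *)
Lemma heisenberg_generated_full (A B : {vspace L}) :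
  (lie_generated A B == fullv) = (A + B + Z == fullv)%VS.
Proof.
have [subG sAG sBG minG] := lie_generatedP A B; apply/eqP/eqP => [defL | defL].
  apply/eqP; rewrite eqEsubv subvf -[X in (X <= _)%VS]defL.
  apply: minG; first by rewrite (lie_subalgebra_above_center basisL) ?addvSr.
    by rewrite -addvA addvSl.
  exact: subv_trans (addvSr A B) (addvSl _ _).
apply: (lie_subalgebra_add_center basisL) => //; apply/eqP.
by rewrite eqEsubv subvf -defL addvS // subv_add sAG.
Qed.

Lemma mem_lines U : (U \in lines) = (\dim U == 1).
Proof. by rewrite inE andbC; case: eqP => // /lie_subalgebra_dim1->. Qed.

(** If [h] were outside a two-dimensional subalgebra [U], then [U + Z] would have dimension 3,
    forcing [U = fullv]. *)
Lemma mem_planes U : (U \in planes) = (\dim U == 2) && (Z <= U)%VS.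
Proof.
rewrite inE andbC; case: eqP => //= dimU.
apply/idP/idP=> [subU|]; last exact: (lie_subalgebra_above_center basisL).
apply: contraT => U'h; suff defU : U = fullv.
  by move: dimU; rewrite defU (dim_heisenberg basisL).
apply: (lie_subalgebra_add_center basisL) => //; apply/eqP.
by rewrite eqEdim subvf (dim_heisenberg basisL) dim_add_line // dimU.
Qed.

Lemma comaximal_verticesE : vertices G = lines :|: planes.
Proof.
apply/setP=> U; rewrite 4!inE -andb_orr -dimv_eq0.
have -> : (U == fullv) = (\dim U == 3).
  rewrite eqEdim subvf (dim_heisenberg basisL) eqn_leq.
  by rewrite -{2}(dim_heisenberg basisL) dimvS ?subvf.
have := dimvS (subvf U); rewrite (dim_heisenberg basisL).
by case: (\dim U) => [|[|[|[|]]]].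
Qed.

Lemma noncentral_linesE : nclines = lines :\ Z.
Proof.
apply/setP=> U; rewrite in_setD1 [RHS]andbC [LHS]in_set.
rewrite (heisenberg_center basisL).
apply: andb_id2l; rewrite mem_lines => /eqP dimU.
by rewrite eqEdim dimU (dim_heisenberg_center basisL) andbT.
Qed.

Lemma add_center_noncentral_line A : A \in nclines -> (A + Z)%VS \in planes.
Proof.
rewrite noncentral_linesE in_setD1 mem_lines mem_planes addvSr andbT.
case/andP=> neqAZ /eqP dimA; rewrite dim_add_line ?dimA //.
apply: contra neqAZ => Ah.
by rewrite eq_sym eqEdim -memvE Ah dimA (dim_heisenberg_center basisL).
Qed.

Lemma add_center_plane P : P \in planes -> (P + Z)%VS = P.
Proof. by rewrite mem_planes => /andP[_ /addv_idPl]. Qed.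

Lemma add_center_vertex A :
  A \in nclines :|: planes -> (A + Z)%VS \in planes.
Proof.
rewrite inE => /orP[/add_center_noncentral_line // | pA].
by rewrite add_center_plane.
Qed.

Lemma eq_planes P Q : P \in planes -> Q \in planes -> (P == Q) = (P <= Q)%VS.
Proof.
rewrite !mem_planes => /andP[/eqP dimP _] /andP[/eqP dimQ _].
by rewrite eqEdim dimP dimQ andbT.
Qed.

Lemma eq_add_center A P :
  A \in nclines -> P \in planes -> ((A + Z)%VS == P) = (A <= P)%VS.
Proof.
move=> ncA pP; rewrite eq_planes ?add_center_noncentral_line // subv_add.
by move: pP; rewrite mem_planes => /andP[_ ->]; rewrite andbT.
Qed.

(** All adjacency claims and the degrees are read off from this criterion. It compares the planes
    [A + Z] and [B + Z], whose sum is [L] exactly when they differ. *)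
Lemma comaximal_adjE A B :
  adj G A B = [&& A \in nclines :|: planes, B \in nclines :|: planes
                & (A + Z != B + Z)%VS].
Proof.
have VE U : (U \in vertices G) = (U == Z) || (U \in nclines :|: planes).
  rewrite comaximal_verticesE noncentral_linesE !in_setU in_setD1.
  by case: eqP => //= ->; rewrite mem_lines (dim_heisenberg_center basisL).
(* A neighbour [U] of [Z] would satisfy [U + Z = fullv], hence be [L] itself, which is not a
   vertex. *)
have adjZ U : adj G Z U = false.
  apply/negP=> /and4P[_]; rewrite inE heisenberg_generated_full.
  case/and3P=> subU _ /eqP nfU _.
  move/eqP; rewrite [(Z + U)%VS]addvC -addvA addvv.
  by move/(lie_subalgebra_add_center basisL) => /(_ subU).
have Z'W : Z \notin nclines :|: planes.
  rewrite noncentral_linesE !inE eqxx /=.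
  by rewrite (dim_heisenberg_center basisL) andbF.
have [-> | neqAZ] := eqVneq A Z; first by rewrite adjZ (negPf Z'W).
have [-> | neqBZ] := eqVneq B Z.
  by rewrite adj_sym adjZ (negPf Z'W) andbF.
have /= := VE A; rewrite (negPf neqAZ) => /= VA.
have /= := VE B; rewrite (negPf neqBZ) => /= VB.
rewrite /= /comaximal_adj /= VA VB heisenberg_generated_full.
have [WA | //] := boolP (A \in _); have [WB | //] := boolP (B \in _).
have /= := add_center_vertex WA; have /= := add_center_vertex WB.
have -> : (A + B + Z = (A + Z) + (B + Z))%VS.
  by rewrite -!addvA [(Z + (B + Z))%VS]addvC -addvA addvv.
have [-> | neqAB] := eqVneq A B; first by rewrite eqxx.
move: (A + Z)%VS (B + Z)%VS => P Q pQ pP /=.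
(* Planes have equal dimension, so [P != Q] means that [P + Q] strictly contains [Q]; its dimension
   is then 3. *)
have -> : (P == Q) = (P + Q == Q)%VS.
  by rewrite eq_planes //; apply/addv_idPr/eqP.
move: (pQ) (pP); rewrite !mem_planes => /andP[/eqP dimQ _] /andP[/eqP dimP _].
have [->|neqQ] := eqVneq (P + Q)%VS Q.
  by apply/negbTE/eqP=> defQ; move: dimQ; rewrite defQ (dim_heisenberg basisL).
rewrite eqEdim subvf (dim_heisenberg basisL) -dimQ.
by rewrite ltn_neqAle !(dimv_leqif_eq (addvSr P Q)) eq_sym neqQ.
Qed.

(** The subspaces covering [Z] in [L] are counted by [card_subv_cover]; the factor [q ^ 2 - q]
    cancels because [q > 1]. *)
Lemma card_planes : #|planes| = q.+1.
Proof.
have q_gt1 : 1 < q by apply: finNzRing_gt1.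
have := card_subv_cover (subvf Z).
rewrite (dim_heisenberg basisL) (dim_heisenberg_center basisL).
have -> : [set M : {vspace L} | [&& (Z <= M)%VS, (M <= fullv)%VS
                                 & \dim M == 2]] = planes.
  by apply/setP=> P; rewrite inE mem_planes subvf andbC.
have -> : (q ^ 3 - q ^ 1 = q.+1 * (q ^ 2 - q ^ 1))%N.
  by rewrite expn1 mulnBr !mulSn -!expnS [(q ^ 1 + _)%N]addnC subnDA addKn.
by move/eqP; rewrite eqn_pmul2r ?subn_gt0 ?ltn_exp2l // => /eqP.
Qed.

Lemma card_noncentral_lines_plane P :
  P \in planes -> #|[set A in nclines | (A + Z)%VS == P]| = q.
Proof.
move=> pP; have q_gt1 : 1 < q by apply: finNzRing_gt1.
move: (pP); rewrite mem_planes => /andP[/eqP dimP sZP].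
(* Covering the zero space inside [P] counts all its [q + 1] lines; [cardsD1] then removes [Z]. *)
have := card_subv_cover (sub0v P); rewrite dimP dimv0.
rewrite (cardsD1 Z) !inE sub0v sZP (dim_heisenberg_center basisL) /=.
have -> : (q ^ 2 - q ^ 0 = q.+1 * (q ^ 1 - q ^ 0))%N.
  (* Writing [q ^ 0] as [1 ^ 2] makes this a difference of squares. *)
  by rewrite -[q ^ 0]/(1 ^ 2)%N subn_sqr expn1 mulnC addn1.
move/eqP; rewrite eqn_pmul2r ?subn_gt0 ?ltn_exp2l // add1n eqSS => /eqP <-.
apply: eq_card => A; rewrite in_setD1 [in LHS]in_set [in RHS]in_set sub0v /=.
have [ncA | ] := boolP (A \in nclines); last first.
  rewrite noncentral_linesE in_setD1 mem_lines.
  by case: (A == Z) => //= /negPf->; rewrite andbF.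
rewrite eq_add_center //; move: ncA.
by rewrite noncentral_linesE in_setD1 mem_lines => /andP[-> ->]; rewrite andbT.
Qed.

Lemma card_noncentral_lines : #|nclines| = (q ^ 2 + q)%N.
Proof.
rewrite -sum1_card (partition_big (fun A => A + Z)%VS [in planes]) /=;
  last exact: add_center_noncentral_line.
rewrite -mulnn -mulSnr -card_planes -sum_nat_const; apply: eq_bigr => P pP.
rewrite -(card_noncentral_lines_plane pP) -sum1_card; apply: eq_bigl => A.
by rewrite [RHS]in_set.
Qed.

Lemma noncentral_line_not_plane A : A \in nclines -> A \notin planes.
Proof.
rewrite noncentral_linesE in_setD1 mem_lines mem_planes => /andP[_ /eqP->].
by [].
Qed.

(** The non-neighbours of [A] among the vertices other than [Z] form its own part: the plane [A + Z]
    and its [q] noncentral lines. Removing these [q + 1] from [q ^ 2 + q + (q + 1)] leaves the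
    degree. *)
Lemma degree_comaximal A :
  A \in nclines :|: planes -> degree G A = (q ^ 2 + q)%N.
Proof.
move=> WA; set P := (A + Z)%VS; have pP : P \in planes := add_center_vertex WA.
pose fibre := P |: [set B in nclines | (B + Z)%VS == P].
have -> : degree G A = #|(nclines :|: planes) :\: fibre|.
  apply: eq_card => B; rewrite [LHS]in_set comaximal_adjE WA in_setD.
  rewrite [RHS]andbC /=.
  apply: andb_id2l; rewrite in_setU in_setU1 eq_sym -/P => /orP[ncB | pB].
    rewrite in_set ncB; have [defB|//] := eqVneq B P.
    by case/negP: (noncentral_line_not_plane ncB); rewrite defB.
  have /negbTE ncB := contraL (@noncentral_line_not_plane B) pB.
  by rewrite in_set ncB add_center_plane // orbF.
have sfW : fibre \subset nclines :|: planes.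
  apply/subsetP=> B; rewrite in_setU1 in_set in_setU.
  by case/orP=> [/eqP-> | /andP[-> //]]; rewrite pP orbT.
rewrite cardsDS // cardsU1 card_noncentral_lines_plane // in_set.
have /negbTE-> := contraL (@noncentral_line_not_plane P) pP.
rewrite cardsU card_noncentral_lines card_planes.
have -> : nclines :&: planes = set0.
  apply/setP=> B; rewrite in_setI in_set0; apply/negP=> /andP[ncB].
  exact/negP/noncentral_line_not_plane.
by rewrite cards0 subn0 add1n addnK.
Qed.

End HeisenbergComaximal.

(** * Structure, adjacency and degrees of the comaximal graph, clause by clause *)

Theorem proposition4p3 (F : finFieldType) (L : lieAlgType F) (e f h : L)
    (basisL : heisenberg_basis e f h) :
  let q := #|F| in
  let Z : {vspace L} := <[h]>%VS in
  let G := comaximal_graph L in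
  let lines := lie_lines L in
  let planes := lie_planes L in
  let nclines := noncentral_lines L in
  (* Z = Z(L) = L', the lines and the planes, and the vertex set *)
  [/\ lie_center L = Z, lie_derived L = Z & Z \in lines] /\
  [/\ nclines = lines :\ Z, #|nclines| = (q ^ 2 + q)%N,
      planes = [set U : {vspace L} | (\dim U == 2%N) && (Z <= U)%VS] &
      #|planes| = q.+1] /\
  (vertices G = lines :|: planes /\ [disjoint lines & planes]) /\
  (* plane-plane adjacency *)
  ({in planes &, forall A B, A != B -> adj G A B} /\
   graph_iso (induced G planes) (complete_graph q.+1)) /\
  (* line-line adjacency *)
  [/\ isolated G Z,
      {in nclines &, forall A B, A != B ->
         (adj G A B <->
          ~ exists2 P, P \in planes & (A <= P)%VS && (B <= P)%VS)} &
      graph_iso (induced G (lines :\ Z))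
                (complete_multipartite_graph (fun _ : 'I_q.+1 => q))] /\
  (* line-plane adjacency *)
  ({in lines & planes, forall A B, adj G A B <-> ~~ (A <= B)%VS} /\
   isolated G Z) /\
  (* degrees *)
  {in nclines, forall A, degree G A = (q ^ 2 + q)%N} /\
  {in planes, forall B, degree G B = (q ^ 2 + q)%N}.
Proof.
move=> q Z G lines planes nclines.
have WE U : U \in nclines -> U \in nclines :|: planes.
  by move=> ncU; apply/setUP; left.
have WP U : U \in planes -> U \in nclines :|: planes.
  by move=> pU; apply/setUP; right.
have Zl : Z \in lines by rewrite mem_lines (dim_heisenberg_center basisL).
have lnc : noncentral_lines L = lines :\ Z := noncentral_linesE basisL.
have isoZ : isolated G Z.
  split=> [|U]; first by rewrite (comaximal_verticesE basisL) in_setU Zl.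
  rewrite (comaximal_adjE basisL) in_setU lnc !inE eqxx.
  by rewrite (dim_heisenberg_center basisL) andbF.
have adjPP : {in planes &, forall A B, adj G A B = (A != B)}.
  move=> A B pA pB; rewrite (comaximal_adjE basisL) !WP //.
  by rewrite !(add_center_plane basisL).
(* [induced] intersects [S] with the vertex set, so this identifies the vertices of both induced
   subgraphs. *)
have vSub (S : {set {vspace L}}) :
  S \subset lines :|: planes -> vertices G :&: S = S.
  by rewrite (comaximal_verticesE basisL) => /setIidPr.
split; [split=> // | split; [split=> // | split; [split | split; [split |
  split; [split=> // | split; [split=> // | split]]]]]].
- exact: heisenberg_center basisL.
- exact: heisenberg_derived basisL.
- exact: card_noncentral_lines basisL.
- by apply/setP=> U; rewrite (mem_planes basisL) in_set.
- exact: card_planes basisL.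
- exact: comaximal_verticesE basisL.
- rewrite disjoint_subset; apply/subsetP=> U.
  by rewrite mem_lines inE (mem_planes basisL) => /eqP->.
- by move=> A B pA pB; rewrite adjPP.
- have vP : vertices (induced G planes) = planes.
    by apply: vSub; apply: subsetUr.
  apply: graph_iso_complete; rewrite vP; first exact: card_planes basisL.
  by move=> A B pA pB; rewrite induced_adjE pA pB adjPP.
- move=> A B ncA ncB _; rewrite (comaximal_adjE basisL) !WE //=.
  have pA := add_center_noncentral_line basisL ncA.
  (* The only plane containing a noncentral line [A] is [A + Z], so a common plane of [A] and [B]
     exists iff [A + Z = B + Z]. *)
  split=> [neqAB [P pP] | noP].
    rewrite -!(eq_add_center basisL) // => /andP[/eqP defP].
    by rewrite -defP eq_sym (negPf neqAB).
  apply/eqP=> eqAB; case: noP; exists (A + Z)%VS => //.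
  by rewrite addvSl [(A + Z)%VS]eqAB addvSl.
- rewrite -[lines :\ Z]lnc -/nclines.
  have vN : vertices (induced G nclines) = nclines.
    apply: vSub; rewrite /nclines lnc.
    exact: subset_trans (subD1set _ _) (subsetUl _ _).
  apply: (@graph_iso_multipartite _ _ _ planes (fun A => A + Z)%VS);
    rewrite ?vN.
  + exact: card_planes basisL.
  + exact: add_center_noncentral_line basisL.
  + exact: card_noncentral_lines_plane basisL.
  + move=> A B ncA ncB; rewrite induced_adjE ncA ncB.
    by rewrite (comaximal_adjE basisL) !WE.
(* For [A = Z] both sides are false, since every plane contains [Z]; otherwise [B + Z = B] and the
   criterion compares [A + Z] with [B]. *)
- move=> A B lA pB; have [-> | neqAZ] := eqVneq A Z.
    have [_ /(_ B)/negPf->] := isoZ.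
    by move: pB; rewrite (mem_planes basisL) => /andP[_ ->].
  have ncA : A \in nclines by rewrite /nclines lnc in_setD1 neqAZ.
  rewrite (comaximal_adjE basisL) WE // WP //= (add_center_plane basisL pB).
  by rewrite -(eq_add_center basisL ncA pB).
- by move=> A /WE WA; apply: (degree_comaximal basisL WA).
- by move=> A /WP WA; apply: (degree_comaximal basisL WA).
Qed.
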